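(* Consider Cartan's overdetermined system $R=\{r=t^3/3,\ s=t^2/2\}\subset J^2(\mathbb R^2,\mathbb R)$ with its canonical system $D$, and the open subset $U_{xt}$ of its rank $2$ prolongation $(\Sigma(R),\hat D)$, with coordinates $(x,y,z,p,q,t,b)$. Looking for integral submanifolds $S$ of $(U_{xt},\hat D)$ that are graphs $$(x,\ y(x,t),\ z(x,t),\ p(x,t),\ q(x,t),\ t,\ b(x,t))$$ and pass through $\Sigma_1$ (the condition for this being $y_t(0,0)=0$), one obtains the singular solutions of the form $$y=-xt+y_0(t),$$ $$z=\frac{x^2t^3}{6}-x\Big\{\frac{t^2y_0(t)}{2}+\int t y_0(t)\,dt-t\int y_0(t)\,dt\Big\}+\frac{t\,y_0^2(t)}{2}+\frac12\int y_0^2(t)\,dt-y_0(t)\int y_0(t)\,dt,$$ $$p=-\frac{t^3x}{6}+\frac{t^2y_0(t)}{2}-\int t y_0(t)\,dt,\qquad q=-\frac{t^2x}{2}+t\,y_0(t)-\int y_0(t)\,dt,\qquad b=-x+y_0'(t),$$ where $y_0(t)$ is a function on $S$ depending only on $t$ which satisfies $y_0'(0)=0$. From this condition $y_0'(0)=0$, these solutions have singularities at the origin in $J^1(\mathbb R^2,\mathbb R)$.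
   Context: $J^1(\mathbb R^2,\mathbb R)=\{(x,y,z,p,q)\}$, $J^2(\mathbb R^2,\mathbb R)=\{(x,y,z,p,q,r,s,t)\}$, and $\pi^2_1:J^2\to J^1$ is the natural projection. On $R=\{r=t^3/3,\ s=t^2/2\}$, with coordinates $(x,y,z,p,q,t)$, the canonical system is $D=\{\varpi_0=\varpi_1=\varpi_2=0\}$ with $\varpi_0=dz-p\,dx-q\,dy$, $\varpi_1=dp-\frac{t^3}{3}dx-\frac{t^2}{2}dy$, $\varpi_2=dq-\frac{t^2}{2}dx-t\,dy$. The rank $2$ prolongation $\Sigma(R)$ is the set of $2$-dimensional integral elements of $D$: $2$-planes $w\subset D(v)$, $v\in R$, with $d\varpi_i|_w=0$ for all $i$. $U_{xt}\subset\Sigma(R)$ is the open subset of those $w$ with $dx|_w\wedge dt|_w\neq0$; such $w$ satisfy $dy|_w=-t\,dx|_w+b\,dt|_w$ with $b$ a fiber coordinate, which gives coordinates $(x,y,z,p,q,t,b)$ on $U_{xt}$. On $U_{xt}$ the canonical system $\hat D$ (at $w$, the vectors whose projection to $TR$ lies in $w$) is $\hat D=\{\varpi_0=\varpi_1=\varpi_2=\varpi_y=0\}$ with $\varpi_y=dy+t\,dx-b\,dt$. $\Sigma_1$ is the set of $w\in\Sigma(R)$ meeting the kernel of $(\pi^2_1|_R)_*$ in dimension $1$; in $U_{xt}$ it is the locus $\{b=0\}$. An integral submanifold of $\hat D$ is a submanifold on which all the defining $1$-forms vanish. A geometric solution of $(R,D)$ is a $2$-dimensional integral manifold of $D$ in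 $R$ on which $\pi^2_1$ is an immersion on an open dense subset; it is a singular solution if it has a non-immersion point. *)

(* Defs.v *)
From HB Require Import structures.
From mathcomp Require Import all_boot all_order all_algebra.
From mathcomp Require Import all_classical all_reals all_analysis.

Set Implicit Arguments.
Unset Strict Implicit.
Unset Printing Implicit Defensive.

Import Order.TTheory GRing.Theory Num.Theory.
Import numFieldNormedType.Exports.

Local Open Scope classical_set_scope.
Local Open Scope ring_scope.

Section Calculus.
Context {R : realType}.

(* For an open set A and finite-dimensional V this is C^oo on A: all iterated
   directional derivatives exist on A and are differentiable there. *)
Definition smooth_on (V W : normedModType R) (A : set V) (f : V -> W) : Prop :=
  forall (hs : seq V) (v : V), A v ->
    differentiable (foldr (fun h (g : V -> W) => 'D_h g) f hs) v.

Definition immersion_at (V W : normedModType R) (f : V -> W) (v : V) : Prop :=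
  differentiable f v /\ forall h : V, 'd f v h = 0 -> h = 0.

(* The last conjunct is the continuity of the inverse of f : A -> f @` A. *)
Definition smooth_embedding (V W : normedModType R) (A : set V) (f : V -> W) :
    Prop :=
  [/\ smooth_on A f,
      forall v, A v -> immersion_at f v,
      {in A &, injective f} &
      forall v N, A v -> nbhs v N ->
        exists2 M, nbhs (f v) M & forall v', A v' -> M (f v') -> N v'].

(* A differential 1-form on R^n, as a function of a point and of a tangent
   vector at this point. *)
Definition form1 (n : nat) := 'rV[R]_n -> 'rV[R]_n -> R.

(* The exterior derivative, evaluated on constant vector fields h and k. *)
Definition dform n (w : form1 n.+1) (v h k : 'rV[R]_n.+1) : R :=
  'D_h (fun v' => w v' k) v - 'D_k (fun v' => w v' h) v.

(* f parametrizes, by the open set A, an embedded submanifold on which all the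
   forms of D vanish. *)
Definition integral_submanifold (V : normedModType R) n (D : set (form1 n.+1))
    (A : set V) (f : V -> 'rV[R]_n.+1) : Prop :=
  smooth_embedding A f /\
  forall w, D w -> forall v h, A v -> w (f v) ('d f v h) = 0.

Definition row_of_seq n (s : seq R) : 'rV[R]_n := \row_(i < n) s`_i.

End Calculus.

Section JetSpaces.
Context {R : realType}.

Definition crd n (k : nat) (v : 'rV[R]_n.+1) : R := v ord0 (inord k).

(* The ordering of coordinates is (x,y,z,p,q) on J^1, (x,y,z,p,q,r,s,t) on J^2,
   (x,y,z,p,q,t) on Cartan's system and (x,y,z,p,q,t,b) on U_xt.  In
   particular ct is the coordinate t on the last two spaces only. *)
Definition cx n (v : 'rV[R]_n.+1) : R := crd 0 v.
Definition cy n (v : 'rV[R]_n.+1) : R := crd 1 v.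
Definition cz n (v : 'rV[R]_n.+1) : R := crd 2 v.
Definition cp n (v : 'rV[R]_n.+1) : R := crd 3 v.
Definition cq n (v : 'rV[R]_n.+1) : R := crd 4 v.
Definition ct n (v : 'rV[R]_n.+1) : R := crd 5 v.
Definition cb n (v : 'rV[R]_n.+1) : R := crd 6 v.

Definition pi21 (j : 'rV[R]_8) : 'rV[R]_5 :=
  row_of_seq 5 [:: cx j; cy j; cz j; cp j; cq j].

Definition cartan_system : set 'rV[R]_8 :=
  [set j | crd 5 j = crd 7 j ^+ 3 / 3 /\ crd 6 j = crd 7 j ^+ 2 / 2].

Definition cartan_param (v : 'rV[R]_6) : 'rV[R]_8 :=
  row_of_seq 8 [:: cx v; cy v; cz v; cp v; cq v;
                   ct v ^+ 3 / 3; ct v ^+ 2 / 2; ct v].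

Lemma range_cartan_param : range cartan_param = cartan_system.
Proof.
apply/seteqP; split => [_ [v _ <-]|j /= [e5 e6]].
  by rewrite /cartan_system /= /crd !mxE !inordK.
exists (row_of_seq 6 [:: cx j; cy j; cz j; cp j; cq j; crd 7 j]) => //.
apply/rowP => i; rewrite mxE /cx /cy /cz /cp /cq /ct /crd !mxE !inordK //=.
rewrite -/(crd 7 j) -e5 -e6 /crd.
case: i => -[|[|[|[|[|[|[|[|//]]]]]]]] hi /=; congr (j _ _);
  by apply/val_inj; rewrite /= inordK.
Qed.

(* pi^2_1 restricted to Cartan's system, in the coordinates above. *)
Definition piR (v : 'rV[R]_6) : 'rV[R]_5 := pi21 (cartan_param v).

(* The following forms are used both on Cartan's system (n = 5) and, pulled
   back by projR, on U_xt (n = 6); v is the point and h the tangent vector, so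
   that for instance dz is cz h. *)
Definition varpi0 n (v h : 'rV[R]_n.+1) : R :=
  cz h - cp v * cx h - cq v * cy h.
Definition varpi1 n (v h : 'rV[R]_n.+1) : R :=
  cp h - ct v ^+ 3 / 3 * cx h - ct v ^+ 2 / 2 * cy h.
Definition varpi2 n (v h : 'rV[R]_n.+1) : R :=
  cq h - ct v ^+ 2 / 2 * cx h - ct v * cy h.
Definition varpiy (c h : 'rV[R]_7) : R :=
  cy h + ct c * cx h - cb c * ct h.

Definition Dforms : set (form1 6) :=
  [set @varpi0 5; @varpi1 5; @varpi2 5].
Definition Dhat_forms : set (form1 7) :=
  [set @varpi0 6; @varpi1 6; @varpi2 6; varpiy].

Definition projR (c : 'rV[R]_7) : 'rV[R]_6 :=
  row_of_seq 6 [:: cx c; cy c; cz c; cp c; cq c; ct c].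

(* The rank 2 prolongation: pairs of a point and of a 2-dimensional integral
   element at this point. *)
Definition Sigma : set ('rV[R]_6 * {vspace 'rV[R]_6}) :=
  [set e | [/\ \dim e.2 = 2%N,
    forall w, Dforms w -> forall h, h \in e.2 -> w e.1 h = 0 &
    forall w, Dforms w -> forall h k, h \in e.2 -> k \in e.2 ->
      dform w e.1 h k = 0]].

(* dx /\ dt does not vanish on the plane. *)
Definition Uxt : set ('rV[R]_6 * {vspace 'rV[R]_6}) :=
  [set e | Sigma e /\ exists h k, [/\ h \in e.2, k \in e.2 &
    cx h * ct k - cx k * ct h != 0]].

Definition Uxt_coordinates (e : 'rV[R]_6 * {vspace 'rV[R]_6}) (c : 'rV[R]_7) :
    Prop :=
  [/\ Uxt e, e.1 = projR c &
      forall h, h \in e.2 -> cy h = - ct c * cx h + cb c * ct h].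

Definition Sigma1 : set ('rV[R]_6 * {vspace 'rV[R]_6}) :=
  [set e | Sigma e /\ \dim (e.2 :&: lker (linfun ('d piR (e.1)))) = 1%N].

(* f parametrizes, by the open set A, a 2-dimensional submanifold of Cartan's
   system. *)
Definition geometric_solution (A : set 'rV[R]_2) (f : 'rV[R]_2 -> 'rV[R]_6) :
    Prop :=
  integral_submanifold Dforms A f /\
  exists O : set 'rV[R]_2,
    [/\ open O, O `<=` A, A `<=` closure O &
        forall v, O v -> immersion_at (piR \o f) v].

Definition singular_solution (A : set 'rV[R]_2) (f : 'rV[R]_2 -> 'rV[R]_6) :
    Prop :=
  geometric_solution A f /\ exists2 v, A v & ~ immersion_at (piR \o f) v.

Definition pt (x t : R) : 'rV[R]_2 := row_of_seq 2 [:: x; t].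

Definition graph (y z p q b : R -> R -> R) (v : 'rV[R]_2) : 'rV[R]_7 :=
  let x := crd 0 v in let t := crd 1 v in
  row_of_seq 7 [:: x; y x t; z x t; p x t; q x t; t; b x t].

(* The graph meets Sigma_1 over (x,t) = (0,0). *)
Definition through_Sigma1 (y z p q b : R -> R -> R) : Prop :=
  exists2 e, Uxt_coordinates e (graph y z p q b (pt 0 0)) & Sigma1 e.

Definition antiderivative_on (J : set R) (F f : R -> R) : Prop :=
  forall t, J t -> is_derive t 1 F (f t).

(* The explicit solutions over the domain A; Y, P and Q are the indefinite
   integrals of y0, of t * y0 and of y0 ^ 2, each with an arbitrary constant
   which is the same in all its occurrences. *)
Definition explicit_solution (A : set 'rV[R]_2) (y z p q b : R -> R -> R)
    (y0 Y P Q : R -> R) : Prop :=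
  let J := [set t | exists x, A (pt x t)] in
  [/\ smooth_on J y0, derive1 y0 0 = 0,
      [/\ antiderivative_on J Y y0,
          antiderivative_on J P (fun t => t * y0 t) &
          antiderivative_on J Q (fun t => y0 t ^+ 2)] &
      forall x t, A (pt x t) ->
      [/\ y x t = - x * t + y0 t,
          z x t = x ^+ 2 * t ^+ 3 / 6
                  - x * (t ^+ 2 * y0 t / 2 + P t - t * Y t)
                  + t * y0 t ^+ 2 / 2 + Q t / 2 - y0 t * Y t,
          p x t = - (t ^+ 3 * x / 6) + t ^+ 2 * y0 t / 2 - P t,
          q x t = - (t ^+ 2 * x / 2) + t * y0 t - Y t &
          b x t = - x + derive1 y0 t]].

End JetSpaces.

(* Main.v *)
Require Import Defs.
From mathcomp Require Import all_boot all_order all_algebra.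
From mathcomp Require Import all_classical all_reals all_analysis.
From mathcomp Require Import ring lra.
Import Order.TTheory GRing.Theory Num.Theory.
Import numFieldNormedType.Exports.
Local Open Scope classical_set_scope.
Local Open Scope ring_scope.

(** On an integral graph the equations of the canonical system make
    y + x t,  q + t^2 x / 2,  p + t^3 x / 6  and a similar correction of z
    independent of x, because their x-derivatives vanish and the slices of the
    domain are intervals.  They are therefore functions of t, whose derivatives
    are read off the same equations; solving for y, z, p, q gives the explicit
    formulas.  Moreover dy = - t dx + b dt, and dz, dp, dq are combinations of
    dx and dy, so that the projection of the graph to J^1 fails to be an
    immersion exactly where b = 0.  As b = - x + y0'(t), this locus has a dense
    complement, and the graph meets Sigma_1 over the origin iff y0'(0) = 0. *)

Set Implicit Arguments.
Unset Strict Implicit.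
Unset Printing Implicit Defensive.

(** * Smooth functions *)

Section SmoothFunctions.
Context {R : realType}.
Implicit Types V W U : normedModType R.

Lemma near_eq_differentiable V W (f g : V -> W) v :
  (\near v, f v = g v) -> differentiable g v -> differentiable f v.
Proof.
move=> fg dg; pose k := f - g.
have k0 : \forall u \near v, k u = 0.
  by near do (rewrite /k fctE; apply/eqP; rewrite subr_eq0; apply/eqP).
pose z : {linear V -> W} := \0.
have zc : continuous z by exact: cst_continuous.
have kE : k \o shift v = cst (k v) + z +o_ 0 id.
  apply/eqaddoP => e e0.
  have : \forall u \near (0 : V), k (u + v) = 0.
    have := k0; rewrite (near_shift 0)/=.
    by apply: filterS => u /=; rewrite subr0.
  apply: filterS => u; rewrite !fctE /= => ->.
  by rewrite (nbhs_singleton k0) addr0 subr0 normr0 mulr_ge0// ltW.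
have dk0 : 'd k v = z :> (V -> W) by exact: diff_unique.
have dk : differentiable k v by apply/diff_locallyP; rewrite dk0.
have -> : f = g + k by rewrite /k addrC subrK.
exact: differentiableD.
Unshelve. all: by end_near. Qed.

(* Smoothness as an induction on the order: products are then handled without a
   Leibniz formula for iterated derivatives. *)
Fixpoint smooth_upto n V W (A : set V) (f : V -> W) : Prop :=
  (forall v, A v -> differentiable f v) /\
  if n is n'.+1 then forall h, smooth_upto n' A ('D_h f) else True.

Lemma smooth_onP V W (A : set V) (f : V -> W) :
  smooth_on A f <-> forall n, smooth_upto n A f.
Proof.
split=> [fA n|fA hs].
  elim: n f fA => [|n IHn] f fA /=; first by split=> // v; exact: (fA [::]).
  split=> [v|h]; first exact: (fA [::]).
  apply: IHn => hs v Av; have := fA (rcons hs h) v Av.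
  by rewrite foldr_rcons.
elim/last_ind: hs f fA => [|hs h IHhs] f fA v Av /=.
  by have [+ _] := fA 0%N; exact.
rewrite foldr_rcons; apply: IHhs => // n.
by have [_ +] := fA n.+1; exact.
Qed.

Lemma smooth_on_differentiable V W (A : set V) (f : V -> W) v :
  smooth_on A f -> A v -> differentiable f v.
Proof. by move=> /(_ [::]); exact. Qed.

Lemma smooth_on_derive V W (A : set V) (f : V -> W) h :
  smooth_on A f -> smooth_on A ('D_h f).
Proof. by move=> fA hs v Av; have := fA (rcons hs h) v Av; rewrite foldr_rcons. Qed.

Lemma smooth_upto_differentiable n V W (A : set V) (f : V -> W) v :
  smooth_upto n A f -> A v -> differentiable f v.
Proof. by case: n => [|n] [+ _]; exact. Qed.

Lemma smooth_upto_pred n V W (A : set V) (f : V -> W) :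
  smooth_upto n.+1 A f -> smooth_upto n A f.
Proof.
elim: n f => [|n IHn] f [fA dfA]; split=> // h.
exact/IHn/dfA.
Qed.

Lemma near_eq_smooth_upto n V W (A : set V) (f g : V -> W) :
  (forall v, A v -> \forall u \near v, f u = g u) ->
  smooth_upto n A g -> smooth_upto n A f.
Proof.
elim: n f g => [|n IHn] f g fg [gA dgA]; split => //.
- by move=> v Av; apply: (near_eq_differentiable (fg v Av)); exact: gA.
- by move=> v Av; apply: (near_eq_differentiable (fg v Av)); exact: gA.
- move=> h; apply: (IHn _ ('D_h g)); last exact: dgA.
  move=> v Av.
  have := near_join (fg v Av); apply: filterS => u.
  exact: near_eq_derive.
Qed.

Lemma open_eq_smooth_upto n V W (A : set V) (f g : V -> W) : open A ->
  (forall v, A v -> f v = g v) -> smooth_upto n A g -> smooth_upto n A f.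
Proof.
move=> oA fg; apply: near_eq_smooth_upto => v Av.
by have := open_nbhs_nbhs (conj oA Av); apply: filterS.
Qed.

Lemma near_eq_smooth V W (A : set V) (f g : V -> W) :
  (forall v, A v -> \forall u \near v, f u = g u) ->
  smooth_on A g -> smooth_on A f.
Proof.
move=> fg /smooth_onP gA; apply/smooth_onP => n.
exact: near_eq_smooth_upto fg _.
Qed.

Lemma open_eq_smooth V W (A : set V) (f g : V -> W) : open A ->
  (forall v, A v -> f v = g v) -> smooth_on A g -> smooth_on A f.
Proof.
move=> oA fg /smooth_onP gA; apply/smooth_onP => n.
exact: open_eq_smooth_upto oA fg _.
Qed.

Lemma smooth_cst V W (A : set V) (c : W) : smooth_on A (cst c).
Proof.
apply/smooth_onP => n; elim: n c => [|n IHn] c; split=> //.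
by move=> h; rewrite (_ : 'D_h _ = cst 0)//; apply/funext => v; exact: derive_cst.
Qed.

Lemma smooth_uptoD n V W (A : set V) (f g : V -> W) : open A ->
  smooth_upto n A f -> smooth_upto n A g -> smooth_upto n A (f + g).
Proof.
move=> oA; elim: n f g => [|n IHn] f g [fA dfA] [gA dgA].
  by split => // v Av; apply: differentiableD; [exact: fA|exact: gA].
split=> [v Av|h]; first by apply: differentiableD; [exact: fA|exact: gA].
apply: (@open_eq_smooth_upto _ _ _ _ _ ('D_h f + 'D_h g)) => //.
  by move=> v Av; apply: deriveD; apply: diff_derivable; [exact: fA|exact: gA].
by apply: IHn; [exact: dfA|exact: dgA].
Qed.

Lemma smooth_uptoM n V (A : set V) (f g : V -> R) : open A ->
  smooth_upto n A f -> smooth_upto n A g -> smooth_upto n A (f * g).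
Proof.
move=> oA; elim: n f g => [|n IHn] f g fA gA;
  have df v : A v -> differentiable f v := smooth_upto_differentiable fA;
  have dg v : A v -> differentiable g v := smooth_upto_differentiable gA.
  by split => // v Av; apply: differentiableM; [exact: df|exact: dg].
split=> [v Av|h]; first by apply: differentiableM; [exact: df|exact: dg].
apply: (@open_eq_smooth_upto _ _ _ _ _ (f * 'D_h g + g * 'D_h f)) => //.
  by move=> v Av; apply: deriveM; apply: diff_derivable; [exact: df|exact: dg].
have [[_ dfA] [_ dgA]] := (fA, gA).
apply: smooth_uptoD => //; apply: IHn;
  by [exact: smooth_upto_pred|exact: dfA|exact: dgA].
Qed.

Lemma smoothD V W (A : set V) (f g : V -> W) : open A ->
  smooth_on A f -> smooth_on A g -> smooth_on A (f + g).
Proof.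
move=> oA /smooth_onP fA /smooth_onP gA; apply/smooth_onP => n.
exact: smooth_uptoD.
Qed.

Lemma smoothM V (A : set V) (f g : V -> R) : open A ->
  smooth_on A f -> smooth_on A g -> smooth_on A (f * g).
Proof.
move=> oA /smooth_onP fA /smooth_onP gA; apply/smooth_onP => n.
exact: smooth_uptoM.
Qed.

Lemma smoothN V (A : set V) (f : V -> R) : open A ->
  smooth_on A f -> smooth_on A (- f).
Proof.
move=> oA fA; rewrite (_ : - f = cst (-1) * f).
  by apply: smoothM => //; exact: smooth_cst.
by apply/funext => v; rewrite !fctE mulN1r.
Qed.

Lemma smoothX V (A : set V) (f : V -> R) n : open A ->
  smooth_on A f -> smooth_on A (f ^+ n).
Proof.
move=> oA fA; elim: n => [|n IHn]; first by rewrite expr0; exact: smooth_cst.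
by rewrite exprS; exact: smoothM.
Qed.

Lemma smooth_comp_affine U V W (A : set U) (B : set V) (a : U -> V) (L : U -> V)
    (f : V -> W) : open A -> (forall u, is_diff u a L) -> A `<=` a @^-1` B ->
  smooth_on B f -> smooth_on A (f \o a).
Proof.
move=> oA da AB /smooth_onP fB; apply/smooth_onP => n.
elim: n f {fB}(fB n) => [|n IHn] f [fB dfB].
  by split=> // v Av; apply: differentiable_comp => //; exact/fB/AB.
split=> [v Av|h]; first by apply: differentiable_comp => //; exact/fB/AB.
apply: (@open_eq_smooth_upto _ _ _ _ _ ('D_(L h) f \o a)) => //.
  move=> v Av /=; have dfa := fB _ (AB _ Av).
  rewrite deriveE; last exact: differentiable_comp.
  by rewrite diff_comp//= (@diff_val _ _ _ _ _ _ _ (da v)) deriveE.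
exact/IHn/dfB.
Qed.

Lemma smooth_comp_linear U V W (A : set U) (L : V -> W) (f : U -> V) :
  open A -> (forall u, is_diff u L L) -> smooth_on A f -> smooth_on A (L \o f).
Proof.
move=> oA dL /smooth_onP fA; apply/smooth_onP => n.
elim: n f {fA}(fA n) => [|n IHn] f [fA dfA].
  by split=> // v Av; apply: differentiable_comp => //; exact: fA.
split=> [v Av|h]; first by apply: differentiable_comp => //; exact: fA.
apply: (@open_eq_smooth_upto _ _ _ _ _ (L \o 'D_h f)) => //.
  move=> v Av /=; have dfv := fA _ Av.
  rewrite deriveE; last exact: differentiable_comp.
  by rewrite diff_comp//= (@diff_val _ _ _ _ _ _ _ (dL (f v))) deriveE.
exact/IHn/dfA.
Qed.

Lemma smooth_linear V W (A : set V) (L : V -> W) : (forall u, is_diff u L L) ->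
  smooth_on A L.
Proof.
move=> dL; have dL' u : differentiable L u by exact: ex_diff.
apply/smooth_onP => -[|n]; split => // h.
rewrite (_ : 'D_h L = cst (L h)).
  by have /smooth_onP := @smooth_cst V W A (L h).
by apply/funext => v; rewrite deriveE// (@diff_val _ _ _ _ _ _ _ (dL v)).
Qed.

Lemma smooth_id V (A : set V) : smooth_on A (@id V).
Proof. by apply: smooth_linear => u. Qed.

Lemma smooth_antiderivative (A : set R) (F f : R -> R) : open A ->
  antiderivative_on A F f -> smooth_on A f -> smooth_on A F.
Proof.
move=> oA Ff fA; apply/smooth_onP => n.
have dF t : A t -> differentiable F t.
  by move=> At; apply/derivable1_diffP; have [] := Ff t At.
case: n => [|n]; first by split => // v Av; exact: dF.
split=> [v Av|h]; first exact: dF.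
apply: (@open_eq_smooth_upto _ _ _ _ _ (cst h * f)) => //.
  move=> t At; have dFt := dF t At; rewrite deriveE// diff1E//.
  by rewrite derive1E; have [_ ->] := Ff t At.
have /smooth_onP fA' : smooth_on A (cst h * f).
  by apply: smoothM => //; exact: smooth_cst.
exact: (fA' n).
Qed.

End SmoothFunctions.

Section RowVectors.
Context {R : realType}.
Implicit Types V W : normedModType R.

Lemma is_diff_is_derive V W (f df : V -> W) v h :
  is_diff v f df -> is_derive v h f (df h).
Proof.
move=> fdf; apply: DeriveDef; first exact: diff_derivable.
by rewrite deriveE// diff_val.
Qed.

Lemma differentiable_rowP V n (f : V -> 'rV[R]_n) v :
  (forall i, differentiable (fun u => f u ord0 i) v) -> differentiable f v.
Proof.
move=> df.
have -> : f = \sum_(i < n) (fun u => f u ord0 i *: delta_mx ord0 i).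
  apply/funext => u; rewrite fct_sumE [LHS]row_sum_delta.
  by apply: eq_bigr.
by apply: differentiable_sum => i; exact: differentiableZl.
Qed.

Lemma derive_row V n (f : V -> 'rV[R]_n) v h i : differentiable f v ->
  'D_h f v ord0 i = 'D_h (fun u => f u ord0 i) v.
Proof. by move=> df; rewrite derive_mx ?mxE//; exact: diff_derivable. Qed.

Lemma is_diff_coord n (v : 'rV[R]_n) i :
  is_diff v (fun u : 'rV[R]_n => u ord0 i) (fun u => u ord0 i).
Proof.
apply: DiffDef; first exact: differentiable_coord.
apply/funext => h; rewrite -deriveE; last exact: differentiable_coord.
by rewrite -(@derive_row _ _ id)// derive_id.
Qed.

Lemma is_diff_row V n (f df : V -> 'rV[R]_n) v :
  (forall i, is_diff v (fun u => f u ord0 i) (fun h => df h ord0 i)) ->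
  is_diff v f df.
Proof.
move=> dfi; have fv : differentiable f v by exact: differentiable_rowP.
apply: DiffDef => //; apply/funext => h; rewrite -deriveE//.
apply/rowP => i; rewrite derive_row// deriveE//.
by rewrite (@diff_val _ _ _ _ _ _ _ (dfi i)).
Qed.

Lemma smooth_row V n (A : set V) (f : V -> 'rV[R]_n) : open A ->
  (forall i, smooth_on A (fun u => f u ord0 i)) -> smooth_on A f.
Proof.
move=> oA fA; apply/smooth_onP => k.
have {}fA i : smooth_upto k A (fun u => f u ord0 i) by move: (fA i) => /smooth_onP.
elim: k f fA => [|k IHk] f fA.
  by split=> // v Av; apply: differentiable_rowP => i; have [+ _] := fA i; exact.
have df v : A v -> differentiable f v.
  by move=> Av; apply: differentiable_rowP => i; have [+ _] := fA i; exact.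
split=> // h; apply: IHk => i.
apply: (@open_eq_smooth_upto _ _ _ _ _ _ ('D_h (fun u => f u ord0 i))) => //.
  by move=> v Av; rewrite derive_row//; exact: df.
by have [_ +] := fA i; exact.
Qed.

Lemma crd_row_of_seq n (s : seq R) k : (k < n.+1)%N ->
  crd k (row_of_seq n.+1 s) = s`_k.
Proof. by move=> kn; rewrite /crd mxE inordK. Qed.

Lemma is_diff_crd n k (v : 'rV[R]_n.+1) : is_diff v (crd k) (crd k).
Proof. exact: is_diff_coord. Qed.

Lemma is_derive_crd n k (v h : 'rV[R]_n.+1) : is_derive v h (crd k) (crd k h).
Proof. exact/is_diff_is_derive/is_diff_crd. Qed.

Lemma is_derive_comp_crd n k (g : R -> R) dg (v h : 'rV[R]_n.+1) :
  is_derive (crd k v) 1 g dg -> is_derive v h (g \o crd k) (crd k h * dg).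
Proof.
move=> [dg1 dgE]; have dv := is_diff_crd k v.
have dgv : differentiable g (crd k v) by apply/derivable1_diffP.
apply: DeriveDef; first exact/diff_derivable/differentiable_comp.
rewrite deriveE; last exact: differentiable_comp.
by rewrite diff_comp//= diff1E// derive1E dgE (@diff_val _ _ _ _ _ _ _ dv).
Qed.

Lemma crd0_pt (x t : R) : crd 0 (pt x t) = x.
Proof. by rewrite crd_row_of_seq. Qed.

Lemma crd1_pt (x t : R) : crd 1 (pt x t) = t.
Proof. by rewrite crd_row_of_seq. Qed.

Lemma pt_crd (v : 'rV[R]_2) : pt (crd 0 v) (crd 1 v) = v.
Proof.
apply/rowP => i; rewrite mxE /crd; case: i => -[|[|//]] i2 /=; congr (v _ _);
  by apply/val_inj; rewrite /= inordK.
Qed.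

Lemma is_diff_ptx (x t : R) : is_diff x (fun x => pt x t) (fun h => pt h 0).
Proof.
apply: is_diff_row => -[[|[|//]] i2].
  have ptE s : (fun u => pt u s ord0 (Ordinal i2)) = id.
    by apply/funext => u; rewrite mxE.
  by rewrite !ptE; exact: is_diff_id.
have ptE s : (fun u => pt u s ord0 (Ordinal i2)) = cst s.
  by apply/funext => u; rewrite mxE.
by rewrite !ptE; exact: is_diff_cst.
Qed.

Lemma is_diff_ptt (x t : R) : is_diff t (pt x) (pt 0).
Proof.
apply: is_diff_row => -[[|[|//]] i2].
  have ptE s : (fun u => pt s u ord0 (Ordinal i2)) = cst s.
    by apply/funext => u; rewrite mxE.
  by rewrite !ptE; exact: is_diff_cst.
have ptE s : (fun u => pt s u ord0 (Ordinal i2)) = id.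
  by apply/funext => u; rewrite mxE.
by rewrite !ptE; exact: is_diff_id.
Qed.

Lemma is_derive_ptx W (G : 'rV[R]_2 -> W) x t : differentiable G (pt x t) ->
  is_derive x 1 (fun x => G (pt x t)) ('D_(pt 1 0) G (pt x t)).
Proof.
move=> dG; have dx := is_diff_ptx x t; have dGx := differentiableP dG.
by rewrite deriveE//; exact: is_diff_is_derive (is_diff_comp dx dGx).
Qed.

Lemma is_derive_ptt W (G : 'rV[R]_2 -> W) x t : differentiable G (pt x t) ->
  is_derive t 1 (fun t => G (pt x t)) ('D_(pt 0 1) G (pt x t)).
Proof.
move=> dG; have dt := is_diff_ptt x t; have dGt := differentiableP dG.
by rewrite deriveE//; exact: is_diff_is_derive (is_diff_comp dt dGt).
Qed.

Lemma embedding_of_linear_retraction V W (A : set V) (f : V -> W) (pr : W -> V) :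
  (forall u, is_diff u pr pr) -> cancel f pr -> smooth_on A f ->
  smooth_embedding A f.
Proof.
move=> dpr fK fA; split=> // [v Av|u v _ _|v N Av vN].
- have dfv := smooth_on_differentiable fA Av; split=> // h fh.
  have : 'd (pr \o f) v h = h.
    rewrite (_ : pr \o f = id); last by apply/funext => u /=; rewrite fK.
    by rewrite diff_val.
  rewrite diff_comp//= fh => <-.
  by rewrite linear0.
- exact: (can_inj fK).
- exists (pr @^-1` N); last by move=> v' _ /=; rewrite fK.
  have cpr : {for f v, continuous pr} by exact: differentiable_continuous.
  by apply: cpr; rewrite fK.
Qed.

Section Slices.
Variables (A : set 'rV[R]_2).
Hypothesis Aopen : open A.

Lemma nbhs_slicet x t : A (pt x t) -> \forall t' \near t, A (pt x t').
Proof.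
move=> Axt; have dt := is_diff_ptt x t.
have ct : {for t, continuous (pt x)} by exact: differentiable_continuous.
by apply: ct; exact: open_nbhs_nbhs.
Qed.

Lemma nbhs_slicex x t : A (pt x t) -> \forall x' \near x, A (pt x' t).
Proof.
move=> Axt; have dt := is_diff_ptx x t.
have ct : {for x, continuous (fun x => pt x t)}.
  exact: differentiable_continuous.
by apply: ct; exact: open_nbhs_nbhs.
Qed.

Lemma open_proj_t : open [set t | exists x, A (pt x t)].
Proof.
rewrite openE => t [x Axt]; rewrite /interior /=.
by apply: filterS (nbhs_slicet Axt) => t' ?; exists x.
Qed.

Lemma slice_constant (G : 'rV[R]_2 -> R) t :
  is_interval [set x | A (pt x t)] ->
  (forall x, A (pt x t) -> differentiable G (pt x t)) ->
  (forall x, A (pt x t) -> 'D_(pt 1 0) G (pt x t) = 0) ->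
  forall x x', A (pt x t) -> A (pt x' t) -> G (pt x t) = G (pt x' t).
Proof.
move=> iA dG DG x x'; wlog xx' : x x' / x <= x'.
  by move=> H Ax Ax'; have [/H->//|/ltW/H->//] := leP x x'.
move=> Ax Ax'.
have sub u : u \in `[x, x'] -> A (pt u t).
  by rewrite in_itv/= => ux; exact: (iA _ _ Ax Ax').
have dsub u : u \in `[x, x'] ->
    is_derive u 1 (fun u => G (pt u t)) ('D_(pt 1 0) G (pt u t)).
  by move=> /sub Au; apply: is_derive_ptx; exact: dG.
have cG : {within `[x, x'], continuous (fun u => G (pt u t))}.
  by apply: derivable_within_continuous => u /dsub[].
have dG' u : u \in `]x, x'[ ->
    is_derive u 1 (fun u => G (pt u t)) ('D_(pt 1 0) G (pt u t)).
  by move=> /subset_itv_oo_cc; exact: dsub.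
have [c /sub Ac] := MVT_segment xx' dG' cG.
by rewrite DG// mul0r => /eqP; rewrite subr_eq0 => /eqP ->.
Qed.

Lemma factor_through_t (G : 'rV[R]_2 -> R) :
  (forall t, is_interval [set x | A (pt x t)]) ->
  (forall v, A v -> differentiable G v) ->
  (forall v, A v -> 'D_(pt 1 0) G v = 0) ->
  exists g, forall x t, A (pt x t) -> G (pt x t) = g t.
Proof.
move=> iA dG DG; exists (fun t => G (pt (xget 0 [set x | A (pt x t)]) t)).
move=> x t Axt; apply: (slice_constant (iA t)) => // [u|u|]; first exact: dG.
  exact: DG.
exact: (@xgetI _ _ [set x | A (pt x t)] _ Axt).
Qed.

Variables (G : 'rV[R]_2 -> R) (g : R -> R).
Hypothesis Gg : forall x t, A (pt x t) -> G (pt x t) = g t.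

Lemma near_factor x t : A (pt x t) -> \forall t' \near t, G (pt x t') = g t'.
Proof. by move=> /nbhs_slicet; apply: filterS => t' /Gg. Qed.

Lemma is_derive_factor x t : A (pt x t) -> differentiable G (pt x t) ->
  is_derive t 1 g ('D_(pt 0 1) G (pt x t)).
Proof.
move=> Axt dG.
exact: near_eq_is_derive (near_factor Axt) (is_derive_ptt dG).
Qed.

Lemma smooth_factor : smooth_on A G -> smooth_on [set t | exists x, A (pt x t)] g.
Proof.
move=> GA hs t [x Axt]; pose B := pt x @^-1` A.
have oB : open B.
  rewrite openE => t' Bt'; exact: nbhs_slicet.
suff : smooth_on B g by exact.
apply: (@near_eq_smooth _ _ _ _ _ (G \o pt x)).
  by move=> t' /near_factor; apply: filterS => u /= ->.
exact: (@smooth_comp_affine _ _ _ _ B A _ (pt 0) _ oB (is_diff_ptt x) _ GA).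
Qed.

End Slices.
End RowVectors.

(** * Integral elements of Cartan's system *)

Section Prolongation.
Context {R : realType}.

Lemma crd_ext n (u v : 'rV[R]_n.+1) :
  (forall k, (k < n.+1)%N -> crd k u = crd k v) -> u = v.
Proof.
move=> uv; apply/rowP => i; have := uv i (ltn_ord i).
by rewrite /crd !inord_val.
Qed.

Lemma is_diff_crds n m (f : 'rV[R]_n.+1 -> 'rV[R]_m.+1) v :
  (forall k, (k < m.+1)%N -> is_diff v (crd k \o f) (crd k \o f)) ->
  is_diff v f f.
Proof.
move=> df; apply: is_diff_row => i; have := df i (ltn_ord i).
rewrite (_ : crd i \o f = fun u => f u ord0 i)//.
by apply/funext => u; rewrite /crd /= inord_val.
Qed.

Lemma crd_projR k (c : 'rV[R]_7) : (k < 6)%N -> crd k (projR c) = crd k c.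
Proof. by move=> k6; rewrite crd_row_of_seq//; move: k k6 => [|[|[|[|[|[|]]]]]]. Qed.

Lemma crd_piR k (v : 'rV[R]_6) : (k < 5)%N -> crd k (piR v) = crd k v.
Proof.
move=> k5; rewrite crd_row_of_seq//; move: k k5 => [|[|[|[|[|]]]]]//= _;
  by rewrite [LHS]crd_row_of_seq.
Qed.

Lemma is_diff_projR (c : 'rV[R]_7) : is_diff c projR projR.
Proof.
apply: is_diff_crds => k k6; rewrite (_ : crd k \o projR = crd k).
  exact: is_diff_crd.
by apply/funext => u; exact: crd_projR.
Qed.

Lemma is_diff_piR (v : 'rV[R]_6) : is_diff v piR piR.
Proof.
apply: is_diff_crds => k k5; rewrite (_ : crd k \o piR = crd k).
  exact: is_diff_crd.
by apply/funext => u; exact: crd_piR.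
Qed.

Lemma dform_varpi0 n (v h k : 'rV[R]_n.+1) :
  dform (@varpi0 R n) v h k =
    cp k * cx h + cq k * cy h - cp h * cx k - cq h * cy k.
Proof.
have D h' k' : is_derive v h' (fun v' : 'rV[R]_n.+1 => varpi0 v' k')
    (- cp h' * cx k' - cq h' * cy k').
  have D3 := is_derive_crd 3 v h'; have D4 := is_derive_crd 4 v h'.
  rewrite (_ : (fun _ => _) =
    cst (cz k') - crd 3 * cst (cx k') - crd 4 * cst (cy k'))//.
  by apply: is_derive_eq; rewrite !scaler0 /cp /cq /GRing.scale /=; ring.
by rewrite /dform; have [_ ->] := D h k; have [_ ->] := D k h; ring.
Qed.

Lemma dform_varpi1 n (v h k : 'rV[R]_n.+1) :
  dform (@varpi1 R n) v h k =
    ct v ^+ 2 * (ct k * cx h - ct h * cx k) + ct v * (ct k * cy h - ct h * cy k).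
Proof.
have D h' k' : is_derive v h' (fun v' : 'rV[R]_n.+1 => varpi1 v' k')
    (- (ct v ^+ 2 * ct h' * cx k') - ct v * ct h' * cy k').
  have D5 := is_derive_crd 5 v h'.
  rewrite (_ : (fun _ => _) = cst (cp k') - crd 5 ^+ 3 * cst (3^-1 * cx k')
    - crd 5 ^+ 2 * cst (2^-1 * cy k')); last first.
    by apply/funext => u; rewrite !fctE /varpi1 /ct !mulrA.
  apply: is_derive_eq; rewrite !fctE !scaler0 /ct /GRing.scale /=; by field.
by rewrite /dform; have [_ ->] := D h k; have [_ ->] := D k h; ring.
Qed.

Lemma dform_varpi2 n (v h k : 'rV[R]_n.+1) :
  dform (@varpi2 R n) v h k =
    ct v * (ct k * cx h - ct h * cx k) + (ct k * cy h - ct h * cy k).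
Proof.
have D h' k' : is_derive v h' (fun v' : 'rV[R]_n.+1 => varpi2 v' k')
    (- (ct v * ct h' * cx k') - ct h' * cy k').
  have D5 := is_derive_crd 5 v h'.
  rewrite (_ : (fun _ => _) = cst (cq k') - crd 5 ^+ 2 * cst (2^-1 * cx k')
    - crd 5 * cst (cy k')); last first.
    by apply/funext => u; rewrite !fctE /varpi2 /ct !mulrA.
  apply: is_derive_eq; rewrite !fctE !scaler0 /ct /GRing.scale /=; by field.
by rewrite /dform; have [_ ->] := D h k; have [_ ->] := D k h; ring.
Qed.

Lemma mem_ker_piR (v h : 'rV[R]_6) :
  (h \in lker (linfun ('d piR v))) = (piR h == 0).
Proof.
by rewrite memv_ker lfunE /= (@diff_val _ _ _ _ _ _ _ (is_diff_piR v)).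
Qed.

Lemma piR_eq0 (h : 'rV[R]_6) : piR h = 0 ->
  [/\ cx h = 0, cy h = 0, cz h = 0, cp h = 0 & cq h = 0].
Proof.
move=> h0; have c k : (k < 5)%N -> crd k h = 0.
  by move=> k5; rewrite -crd_piR// h0 /crd mxE.
by split; exact: c.
Qed.

Lemma Sigma1_b0 e (c : 'rV[R]_7) : Uxt_coordinates e c -> Sigma1 e -> cb c = 0.
Proof.
move=> [_ _ ec] [_ dim1].
have : vpick (e.2 :&: lker (linfun ('d piR (e.1)))) != 0.
  by rewrite vpick0 -dimv_eq0 dim1.
have := memv_pick (e.2 :&: lker (linfun ('d piR (e.1)))).
move: (vpick _) => h; rewrite memv_cap mem_ker_piR => /andP[he /eqP h0] hn0.
have [hx hy hz hp hq] := piR_eq0 h0.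
have ht : ct h != 0.
  apply: contra_neq hn0 => ht; apply: crd_ext.
  by move=> [|[|[|[|[|[|]]]]]]// _; rewrite [RHS]mxE.
have := ec h he; rewrite hx hy mulr0 add0r => /esym/eqP.
by rewrite mulf_eq0 (negPf ht) orbF => /eqP.
Qed.

Section Vertical.
Variable c : 'rV[R]_7.
Hypotheses (c_t0 : ct c = 0) (c_b0 : cb c = 0).

Let hx : 'rV[R]_6 := row_of_seq 6 [:: 1; 0; cp c; 0; 0; 0].
Let ht : 'rV[R]_6 := row_of_seq 6 [:: 0; 0; 0; 0; 0; 1].
Let E : {vspace 'rV[R]_6} := (<[hx]> + <[ht]>)%VS.

Let crdE a b k : (k < 6)%N ->
  crd k (a *: hx + b *: ht) = [:: a; 0; a * cp c; 0; 0; b]`_k.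
Proof.
move=> k6; rewrite {1}/crd !mxE inordK//.
by move: k k6 => [|[|[|[|[|[|]]]]]]//= _; ring.
Qed.

Let memE h : (h \in E) <-> exists a b, h = a *: hx + b *: ht.
Proof.
split=> [/memv_addP[_ /vlineP[a ->]] [_ /vlineP[b ->]] ->|[a [b ->]]].
  by exists a, b.
by rewrite memv_add// memvZ// memv_line.
Qed.

Let hx_neq0 : hx != 0.
Proof.
apply/eqP => h0; have := crdE 1 0 (isT : 0 < 6)%N.
by rewrite h0 !scaler0 scale0r addr0 /crd mxE => /esym/eqP; rewrite oner_eq0.
Qed.

Let ht_neq0 : ht != 0.
Proof.
apply/eqP => h0; have := crdE 0 1 (isT : 5 < 6)%N.
by rewrite h0 !scaler0 scale0r addr0 /crd mxE => /esym/eqP; rewrite oner_eq0.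
Qed.

Let dimE : \dim E = 2%N.
Proof.
have cap0 : (<[hx]> :&: <[ht]> = 0)%VS.
  apply/eqP; rewrite -subv0; apply/subvP => h; rewrite memv_cap memv0.
  move=> /andP[/vlineP[a ->] /vlineP[b hab]].
  have : a *: hx + (- b) *: ht = 0 by rewrite hab scaleNr subrr.
  move=> /(congr1 (crd 0)); rewrite crdE//= => ->.
  by rewrite /crd mxE scale0r.
by rewrite dimv_disjoint_sum// !dim_vline hx_neq0 ht_neq0.
Qed.

Let capE : (E :&: lker (linfun ('d piR (projR c))) = <[ht]>)%VS.
Proof.
apply/vspaceP => h; rewrite memv_cap mem_ker_piR; apply/andP/vlineP.
  move=> [/memE[a [b ->]]] /eqP/piR_eq0[]; rewrite /cx crdE//= => -> _ _ _ _.
  by exists b; rewrite scale0r add0r.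
move=> [b ->]; have -> : b *: ht = 0 *: hx + b *: ht by rewrite scale0r add0r.
split; first by apply/memE; exists 0, b.
apply/eqP/crd_ext => k k5; rewrite crd_piR// crdE; last exact: leqW.
by move: k k5 => [|[|[|[|[|]]]]]//= _; rewrite [RHS]mxE ?mul0r.
Qed.

Lemma vertical_element : exists2 e, Uxt_coordinates e c & Sigma1 e.
Proof.
have tc : ct (projR c) = 0 by rewrite [LHS]crd_projR.
have pc : cp (projR c) = cp c by rewrite [LHS]crd_projR.
have SE : Sigma (projR c, E).
  split=> /= [|w Dw h /memE[a [b ->]]|w Dw h k /memE[a [b ->]] /memE[a' [b' ->]]].
  - exact: dimE.
  - move: Dw => [[->|->]|->]; rewrite /varpi0 /varpi1 /varpi2 ?tc ?pc;
      by rewrite /cx /cy /cz /cp /cq !crdE//= -?/(cp c); ring.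
  - move: Dw => [[->|->]|->]; rewrite ?dform_varpi0 ?dform_varpi1 ?dform_varpi2;
      by rewrite ?tc /cx /cy /cz /cp /cq !crdE//=; ring.
have hxE : hx = 1 *: hx + 0 *: ht by rewrite scale1r scale0r addr0.
have htE : ht = 0 *: hx + 1 *: ht by rewrite scale1r scale0r add0r.
exists (projR c, E); last by split; rewrite //= capE dim_vline ht_neq0.
split=> //=.
  split=> //; exists hx, ht => /=; split.
  - by apply/memE; exists 1, 0.
  - by apply/memE; exists 0, 1.
  - by rewrite /cx /ct !crd_row_of_seq//= mulr1 mul0r subr0 oner_neq0.
move=> h /memE[a [b ->]]; rewrite c_t0 c_b0 /cy crdE//=; ring.
Qed.

End Vertical.

Lemma crd_graph (y z p q b : R -> R -> R) v k : (k < 7)%N ->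
  crd k (graph y z p q b v) =
  [:: crd 0 v; y (crd 0 v) (crd 1 v); z (crd 0 v) (crd 1 v);
      p (crd 0 v) (crd 1 v); q (crd 0 v) (crd 1 v); crd 1 v;
      b (crd 0 v) (crd 1 v)]`_k.
Proof. by move=> k7; rewrite /graph crd_row_of_seq. Qed.

Lemma through_Sigma1P (y z p q b : R -> R -> R) :
  through_Sigma1 y z p q b <-> b 0 0 = 0.
Proof.
have cbE : cb (graph y z p q b (pt 0 0)) = b 0 0.
  by rewrite /cb crd_graph//= crd0_pt crd1_pt.
split=> [[e ec e1]|b0]; first by rewrite -cbE; exact: Sigma1_b0 ec e1.
apply: vertical_element; last by rewrite cbE.
by rewrite /ct crd_graph//= crd1_pt.
Qed.

End Prolongation.

(** * Integral graphs *)

Section Graphs.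
Context {R : realType}.
Variables (A : set 'rV[R]_2) (Aopen : open A).
Variables y z p q b : R -> R -> R.

Local Notation S := (graph y z p q b).
Local Notation X := (@crd R 1 0).
Local Notation T := (@crd R 1 1).
Local Notation lift g := (fun v : 'rV[R]_2 => g (X v) (T v)).

Lemma is_diff_pt_cx_ct n (c : 'rV[R]_n.+1) :
  is_diff c (fun c => pt (cx c) (ct c)) (fun c => pt (cx c) (ct c)).
Proof.
apply: is_diff_crds => -[|[|//]] _.
  rewrite (_ : crd 0 \o _ = crd 0); first exact: is_diff_crd.
  by apply/funext => u /=; rewrite crd0_pt.
rewrite (_ : crd 1 \o _ = crd 5); first exact: is_diff_crd.
by apply/funext => u /=; rewrite crd1_pt.
Qed.

Lemma graph_embedding : smooth_on A S -> smooth_embedding A S.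
Proof.
apply: (@embedding_of_linear_retraction _ _ _ _ _ (fun c => pt (cx c) (ct c))).
  exact: is_diff_pt_cx_ct.
by move=> v; rewrite /cx /ct !crd_graph//= pt_crd.
Qed.

Lemma projected_graph_embedding :
  smooth_on A S -> smooth_embedding A (projR \o S).
Proof.
move=> SA.
apply: (@embedding_of_linear_retraction _ _ _ _ _ (fun c => pt (cx c) (ct c))).
- exact: is_diff_pt_cx_ct.
- by move=> v; rewrite /cx /ct !crd_projR// !crd_graph//= pt_crd.
- by apply: smooth_comp_linear SA => // u; exact: is_diff_projR.
Qed.

Lemma crd_diff_graph v h k : differentiable S v -> (k < 7)%N ->
  crd k ('d S v h) = 'D_h (crd k \o S) v.
Proof. by move=> dS k7; rewrite -deriveE// [LHS]derive_row. Qed.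

Lemma diff_graphE v h : differentiable S v ->
  [/\ cx ('d S v h) = crd 0 h, ct ('d S v h) = crd 1 h,
      cy ('d S v h) = 'D_h (lift y) v, cz ('d S v h) = 'D_h (lift z) v &
      cp ('d S v h) = 'D_h (lift p) v /\ cq ('d S v h) = 'D_h (lift q) v].
Proof.
move=> dS; rewrite /cx /ct /cy /cz /cp /cq !crd_diff_graph//.
have D k g : (k < 7)%N -> (forall u, crd k (S u) = g u) -> crd k \o S = g.
  by move=> k7 kg; apply/funext => u; exact: kg.
rewrite (D 0 (crd 0))// ?(D 5 (crd 1))// ?(D 1 (lift y))// ?(D 2 (lift z))//
  ?(D 3 (lift p))// ?(D 4 (lift q))//;
  try by move=> u; rewrite crd_graph.
by have [_ ->] := is_derive_crd 0 v h; have [_ ->] := is_derive_crd 1 v h.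
Qed.

Lemma integral_graphP :
  integral_submanifold Dhat_forms A S <->
  smooth_on A S /\ forall v h, A v ->
    [/\ 'D_h (lift y) v = - T v * X h + lift b v * T h,
        'D_h (lift z) v = lift p v * X h + lift q v * 'D_h (lift y) v,
        'D_h (lift p) v = T v ^+ 3 / 3 * X h + T v ^+ 2 / 2 * 'D_h (lift y) v &
        'D_h (lift q) v = T v ^+ 2 / 2 * X h + T v * 'D_h (lift y) v].
Proof.
have SE v : [/\ cp (S v) = lift p v, cq (S v) = lift q v, ct (S v) = T v &
    cb (S v) = lift b v].
  by rewrite /cp /cq /ct /cb !crd_graph.
split=> [[SA Sint]|[SA Sint]].
  have {}SA : smooth_on A S by case: SA.
  split=> // v h Av; have dS := smooth_on_differentiable SA Av.
  have [hX hT hy hz [hp hq]] := diff_graphE h dS; have [Sp Sq St Sb] := SE v.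
  have i0 : varpi0 (S v) ('d S v h) = 0 by apply: Sint => //; do !left.
  have i1 : varpi1 (S v) ('d S v h) = 0 by apply: Sint => //; left; left; right.
  have i2 : varpi2 (S v) ('d S v h) = 0 by apply: Sint => //; left; right.
  have iy : varpiy (S v) ('d S v h) = 0 by apply: Sint => //; right.
  move: i0 i1 i2 iy; rewrite /varpi0 /varpi1 /varpi2 /varpiy.
  rewrite hX hT hy hz hp hq Sp Sq St Sb.
  move=> i0 i1 i2 iy; split.
  - by apply/eqP; rewrite -subr_eq0 -[X in _ == X]iy; apply/eqP; ring.
  - by apply/eqP; rewrite -subr_eq0 -[X in _ == X]i0; apply/eqP; ring.
  - by apply/eqP; rewrite -subr_eq0 -[X in _ == X]i1; apply/eqP; ring.
  - by apply/eqP; rewrite -subr_eq0 -[X in _ == X]i2; apply/eqP; ring.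
split=> [|w Dw v h Av]; first exact: graph_embedding.
have dS := smooth_on_differentiable SA Av.
have [hX hT hy hz [hp hq]] := diff_graphE h dS; have [Sp Sq St Sb] := SE v.
have [iy i0 i1 i2] := Sint v h Av.
move: Dw => [[[->|->]|->]|->]; rewrite /varpi0 /varpi1 /varpi2 /varpiy;
  rewrite ?hX ?hT ?hy ?hz ?hp ?hq ?Sp ?Sq ?St ?Sb ?i0 ?i1 ?i2 ?iy; ring.
Qed.

Lemma smooth_components : smooth_on A S ->
  [/\ smooth_on A (lift y), smooth_on A (lift z), smooth_on A (lift p),
      smooth_on A (lift q) & smooth_on A (lift b)].
Proof.
move=> SA; have D k g : (forall u, crd k (S u) = g u) -> smooth_on A g.
  move=> kg; rewrite (_ : g = crd k \o S); last by apply/funext => u /=.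
  by apply: smooth_comp_linear SA => // u; exact: is_diff_crd.
split; [apply: (D 1)|apply: (D 2)|apply: (D 3)|apply: (D 4)|apply: (D 6)];
  by move=> u; rewrite crd_graph.
Qed.

Lemma integral_projected_graph : integral_submanifold Dhat_forms A S ->
  integral_submanifold Dforms A (projR \o S).
Proof.
move=> [SA Sint]; have {}SA : smooth_on A S by case: SA.
split=> [|w Dw v h Av]; first exact: projected_graph_embedding.
have dS := smooth_on_differentiable SA Av.
rewrite diff_comp//=; last exact: (@ex_diff _ _ _ _ _ _ _ (is_diff_projR _)).
rewrite (@diff_val _ _ _ _ _ _ _ (is_diff_projR _)).
move: Dw => [[->|->]|->];
  rewrite /varpi0 /varpi1 /varpi2 /cx /cy /cz /cp /cq /ct !crd_projR//.
- by apply: (Sint (@varpi0 R 6)) => //; do !left.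
- by apply: (Sint (@varpi1 R 6)) => //; left; left; right.
- by apply: (Sint (@varpi2 R 6)) => //; left; right.
Qed.

Lemma derive_y_origin : A (pt 0 0) -> integral_submanifold Dhat_forms A S ->
  derive1 (y 0) 0 = b 0 0.
Proof.
move=> A0 /integral_graphP[SA Sint]; have [yA _ _ _ _] := smooth_components SA.
have [Dy _ _ _] := Sint _ (pt 0 1) A0.
move: Dy; rewrite !crd0_pt !crd1_pt mulr0 add0r mulr1 => <-.
have -> : y 0 = (fun t => y (X (pt 0 t)) (T (pt 0 t))).
  by apply/funext => t; rewrite crd0_pt crd1_pt.
by rewrite derive1E; have [] := is_derive_ptt (smooth_on_differentiable yA A0).
Qed.

End Graphs.

(* Instance resolution for [is_derive] is exponential in the size of the function. *)
Ltac derive_rec := lazymatch goal with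
  | |- is_derive _ _ (_ + _) _ =>
      notypeclasses refine (is_deriveD _ _); derive_rec
  | |- is_derive _ _ (_ * _) _ =>
      notypeclasses refine (is_deriveM _ _); derive_rec
  | |- is_derive _ _ (_ ^+ _) _ =>
      notypeclasses refine (is_deriveX _ _); derive_rec
  | |- is_derive _ _ (- _) _ =>
      notypeclasses refine (is_deriveN _); derive_rec
  | |- is_derive _ _ (cst _) _ => exact: is_derive_cst
  | |- _ => eassumption
  end.

Ltac derivation f :=
  notypeclasses refine (is_derive_eq _ _); [rewrite /f; derive_rec|].

Ltac smooth oA := lazymatch goal with
  | |- smooth_on _ (_ + _) => apply: (smoothD oA); smooth oA
  | |- smooth_on _ (_ * _) => apply: (smoothM oA); smooth oA
  | |- smooth_on _ (_ ^+ _) => apply: (smoothX _ oA); smooth oA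
  | |- smooth_on _ (- _) => apply: (smoothN oA); smooth oA
  | |- smooth_on _ (cst _) => exact: smooth_cst
  | |- _ => assumption
  end.

Section Solutions.
Context {R : realType}.
Variables (A : set 'rV[R]_2) (Aopen : open A).
Variables y z p q b : R -> R -> R.

Local Notation S := (graph y z p q b).
Local Notation X := (@crd R 1 0).
Local Notation T := (@crd R 1 1).
Local Notation lift g := (fun v : 'rV[R]_2 => g (X v) (T v)).
Local Notation J := [set t | exists x, A (pt x t)].

Lemma integral_explicit : (forall t, is_interval [set x | A (pt x t)]) ->
  A (pt 0 0) -> integral_submanifold Dhat_forms A S -> b 0 0 = 0 ->
  exists y0 Y P Q, explicit_solution A y z p q b y0 Y P Q.
Proof.
move=> iA A0 /integral_graphP[SA Sint] b00.
have [yA zA pA qA bA] := smooth_components Aopen SA.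
have XA : smooth_on A X by apply: smooth_linear => u; exact: is_diff_crd.
have TA : smooth_on A T by apply: smooth_linear => u; exact: is_diff_crd.
(* The expressions of y0, Y, P and Q obtained by solving the explicit formulas
   for them. *)
pose Gy : 'rV[R]_2 -> R := lift y + X * T.
pose GY : 'rV[R]_2 -> R := T * Gy - lift q - T ^+ 2 * X * cst 2^-1.
pose GP : 'rV[R]_2 -> R := T ^+ 2 * Gy * cst 2^-1 - lift p - T ^+ 3 * X * cst 6^-1.
pose GQ : 'rV[R]_2 -> R := cst 2 * (lift z - X ^+ 2 * T ^+ 3 * cst 6^-1
  + X * (T ^+ 2 * Gy * cst 2^-1 + GP - T * GY)
  - T * Gy ^+ 2 * cst 2^-1 + Gy * GY).
have is_derive_lift (g : 'rV[R]_2 -> R) v h : smooth_on A g -> A v ->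
    is_derive v h g ('D_h g v).
  by move=> gA Av; apply/derivableP/diff_derivable/(smooth_on_differentiable gA).
have DG v h : A v -> [/\ is_derive v h Gy ((lift b v + X v) * T h),
    is_derive v h GY (Gy v * T h), is_derive v h GP (T v * Gy v * T h) &
    is_derive v h GQ (Gy v ^+ 2 * T h)].
  move=> Av; have [ey ez ep eq] := Sint v h Av.
  have DX := is_derive_crd 0 v h; have DT := is_derive_crd 1 v h.
  have Dy := is_derive_lift _ _ h yA Av; have Dz := is_derive_lift _ _ h zA Av.
  have Dp := is_derive_lift _ _ h pA Av; have Dq := is_derive_lift _ _ h qA Av.
  rewrite ez ey in Dz; rewrite ep ey in Dp; rewrite eq ey in Dq; rewrite ey in Dy.
  have DGy : is_derive v h Gy ((lift b v + X v) * T h).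
    by derivation Gy; rewrite /GRing.scale /=; ring.
  have DGY : is_derive v h GY (Gy v * T h).
    derivation GY; rewrite !fctE /GRing.scale /=; rewrite /Gy !fctE.
    by field.
  have DGP : is_derive v h GP (T v * Gy v * T h).
    derivation GP; rewrite !fctE /GRing.scale /=; rewrite /Gy !fctE.
    by field.
  split; [exact: DGy|exact: DGY|exact: DGP|].
  derivation GQ; rewrite !fctE /GRing.scale /=; rewrite /GY /GP /Gy !fctE.
  by field.
have factor (G g : 'rV[R]_2 -> R) : (forall v h, A v -> is_derive v h G (g v * T h)) ->
    (forall v, A v -> differentiable G v) ->
    exists2 f, forall x t, A (pt x t) -> G (pt x t) = f t &
      forall x t, A (pt x t) -> is_derive t 1 f (g (pt x t)).
  move=> dG G1; have [|f Gf] := factor_through_t iA G1.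
    by move=> v Av; have [_ ->] := dG v (pt 1 0) Av; rewrite crd1_pt mulr0.
  exists f => // x t Axt; have := is_derive_factor Aopen Gf Axt (G1 _ Axt).
  by have [_ ->] := dG _ (pt 0 1) Axt; rewrite crd1_pt mulr1.
have GyA : smooth_on A Gy by rewrite /Gy; smooth Aopen.
have GYA : smooth_on A GY by rewrite /GY; smooth Aopen.
have GPA : smooth_on A GP by rewrite /GP; smooth Aopen.
have GQA : smooth_on A GQ by rewrite /GQ; smooth Aopen.
have DGy v h (Av : A v) := let: And4 d _ _ _ := DG v h Av in d.
have dGy v := @smooth_on_differentiable _ _ _ _ _ v GyA.
have [y0 y0E Dy0] := factor Gy (fun v => lift b v + X v) DGy dGy.
have DGY v h (Av : A v) := let: And4 _ d _ _ := DG v h Av in d.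
have dGY v := @smooth_on_differentiable _ _ _ _ _ v GYA.
have [Y YE DY] := factor GY Gy DGY dGY.
have DGP v h (Av : A v) := let: And4 _ _ d _ := DG v h Av in d.
have dGP v := @smooth_on_differentiable _ _ _ _ _ v GPA.
have [P PE DP] := factor GP (fun v => T v * Gy v) DGP dGP.
have DGQ v h (Av : A v) := let: And4 _ _ _ d := DG v h Av in d.
have dGQ v := @smooth_on_differentiable _ _ _ _ _ v GQA.
have [Q QE DQ] := factor GQ (fun v => Gy v ^+ 2) DGQ dGQ.
exists y0, Y, P, Q; split.
- exact: smooth_factor GyA.
- rewrite derive1E; have [_ ->] := Dy0 0 0 A0.
  by rewrite !crd0_pt crd1_pt b00 addr0.
- split=> t [x Axt].
  + by rewrite -(y0E _ _ Axt); exact: DY.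
  + by have := DP _ _ Axt; rewrite crd1_pt (y0E _ _ Axt).
  + by have := DQ _ _ Axt; rewrite (y0E _ _ Axt).
- move=> x t Axt; have [_ y0'] := Dy0 _ _ Axt.
  move: (y0E _ _ Axt) (YE _ _ Axt) (PE _ _ Axt) (QE _ _ Axt) y0'.
  rewrite derive1E /GQ /GP /GY /Gy !fctE !crd0_pt !crd1_pt => <- <- <- <- ->.
  by split; field.
Qed.

Variables y0 Y P Q : R -> R.
Hypothesis sol : explicit_solution A y z p q b y0 Y P Q.

Lemma explicit_integral : integral_submanifold Dhat_forms A S.
Proof.
have [y0J _ [DY DP DQ] E] := sol.
have oJ : open J := open_proj_t Aopen.
have XA : smooth_on A X by apply: smooth_linear => u; exact: is_diff_crd.
have TA : smooth_on A T by apply: smooth_linear => u; exact: is_diff_crd.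
have JT v : A v -> J (T v) by move=> Av; exists (X v); rewrite pt_crd.
have sT (g : R -> R) : smooth_on J g -> smooth_on A (g \o T).
  by move=> gJ; apply: smooth_comp_affine JT gJ => // u; exact: is_diff_crd.
have YJ : smooth_on J Y by exact: smooth_antiderivative DY y0J.
have PJ : smooth_on J P.
  apply: smooth_antiderivative DP _ => //.
  by apply: (@smoothM _ _ _ id) => //; exact: smooth_id.
have QJ : smooth_on J Q.
  by apply: smooth_antiderivative DQ _ => //; exact: (@smoothM _ _ _ y0 y0).
have y0'J : smooth_on J ('D_1 y0) by exact: smooth_on_derive.
pose Fy : 'rV[R]_2 -> R := - X * T + (y0 \o T).
pose Fz : 'rV[R]_2 -> R := X ^+ 2 * T ^+ 3 * cst 6^-1
  - X * (T ^+ 2 * (y0 \o T) * cst 2^-1 + (P \o T) - T * (Y \o T))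
  + T * (y0 \o T) ^+ 2 * cst 2^-1 + (Q \o T) * cst 2^-1 - (y0 \o T) * (Y \o T).
pose Fp : 'rV[R]_2 -> R :=
  - (T ^+ 3 * X * cst 6^-1) + T ^+ 2 * (y0 \o T) * cst 2^-1 - (P \o T).
pose Fq : 'rV[R]_2 -> R :=
  - (T ^+ 2 * X * cst 2^-1) + T * (y0 \o T) - (Y \o T).
pose Fb : 'rV[R]_2 -> R := - X + ('D_1 y0 \o T).
have EF v : A v -> [/\ lift y v = Fy v, lift z v = Fz v, lift p v = Fp v,
    lift q v = Fq v & lift b v = Fb v].
  move=> Av; rewrite -(pt_crd v) in Av; have [ey ez ep eq eb] := E _ _ Av.
  by rewrite ey ez ep eq eb /Fy /Fz /Fp /Fq /Fb !fctE /= derive1E.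
have sy0 := sT _ y0J; have sY := sT _ YJ; have sP := sT _ PJ; have sQ := sT _ QJ.
have sy0' := sT _ y0'J.
have FyA : smooth_on A Fy by rewrite /Fy; smooth Aopen.
have FzA : smooth_on A Fz by rewrite /Fz; smooth Aopen.
have FpA : smooth_on A Fp by rewrite /Fp; smooth Aopen.
have FqA : smooth_on A Fq by rewrite /Fq; smooth Aopen.
have FbA : smooth_on A Fb by rewrite /Fb; smooth Aopen.
apply/integral_graphP; split=> [|v h Av].
  apply: smooth_row => // i; rewrite -(inord_val i).
  have SF F : (forall v, A v -> crd i (S v) = F v) -> smooth_on A F ->
      smooth_on A (fun u => S u ord0 (inord i)).
    by move=> SF; exact: open_eq_smooth.
  case: i SF => -[|[|[|[|[|[|[|//]]]]]]] /= _ SF.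
  + by apply: (SF _ _ XA) => v _; rewrite crd_graph.
  + by apply: (SF _ _ FyA) => v /EF[e _ _ _ _]; rewrite crd_graph.
  + by apply: (SF _ _ FzA) => v /EF[_ e _ _ _]; rewrite crd_graph.
  + by apply: (SF _ _ FpA) => v /EF[_ _ e _ _]; rewrite crd_graph.
  + by apply: (SF _ _ FqA) => v /EF[_ _ _ e _]; rewrite crd_graph.
  + by apply: (SF _ _ TA) => v _; rewrite crd_graph.
  + by apply: (SF _ _ FbA) => v /EF[_ _ _ _ e]; rewrite crd_graph.
have DX := is_derive_crd 0 v h; have DT := is_derive_crd 1 v h.
have dy0 : is_derive (T v) 1 y0 ('D_1 y0 (T v)).
  by apply/derivableP/diff_derivable/(smooth_on_differentiable y0J)/JT.
have Dy0 := is_derive_comp_crd h dy0.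
have DY0 := is_derive_comp_crd h (DY _ (JT _ Av)).
have DP0 := is_derive_comp_crd h (DP _ (JT _ Av)).
have DQ0 := is_derive_comp_crd h (DQ _ (JT _ Av)).
have near_lift (g F : 'rV[R]_2 -> R) dF : (forall u, A u -> g u = F u) ->
    is_derive v h F dF -> 'D_h g v = dF.
  move=> gF [_ <-]; apply: near_eq_derive.
  by apply: filterS (open_nbhs_nbhs (conj Aopen Av)); exact: gF.
have ey : 'D_h (lift y) v = - T v * X h + Fb v * T h.
  notypeclasses refine (near_lift _ Fy _ _ _).
    by move=> u /EF[e _ _ _ _]; exact: e.
  by derivation Fy; rewrite /Fb !fctE /GRing.scale /=; ring.
have [_ _ Ep Eq Eb] := EF _ Av.
split; rewrite ?ey ?Ep ?Eq ?Eb//.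
- notypeclasses refine (near_lift _ Fz _ _ _).
    by move=> u /EF[_ e _ _ _]; exact: e.
  derivation Fz; rewrite /Fb /Fp /Fq !fctE /GRing.scale /=.
  by field.
- notypeclasses refine (near_lift _ Fp _ _ _).
    by move=> u /EF[_ _ e _ _]; exact: e.
  derivation Fp; rewrite /Fb !fctE /GRing.scale /=.
  by field.
- notypeclasses refine (near_lift _ Fq _ _ _).
    by move=> u /EF[_ _ _ e _]; exact: e.
  derivation Fq; rewrite /Fb !fctE /GRing.scale /=.
  by field.
Qed.

Lemma explicit_b0 : A (pt 0 0) -> b 0 0 = 0.
Proof.
by have [_ y00 _ E] := sol => /E[_ _ _ _ ->]; rewrite y00 oppr0 addr0.
Qed.

End Solutions.

Section Singularities.
Context {R : realType}.
Variables (A : set 'rV[R]_2) (Aopen : open A).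
Variables y z p q b : R -> R -> R.

Local Notation S := (graph y z p q b).
Local Notation f := (projR \o S).
Local Notation X := (@crd R 1 0).
Local Notation T := (@crd R 1 1).
Local Notation lift g := (fun v : 'rV[R]_2 => g (X v) (T v)).

Hypothesis Sint : integral_submanifold Dhat_forms A S.

Lemma smooth_graph : smooth_on A S.
Proof. by have [[]] := Sint. Qed.

Lemma diff_piR_graph v : A v -> differentiable (piR \o f) v /\
  forall h, 'd (piR \o f) v h = piR (projR ('d S v h)).
Proof.
move=> Av; have dS := smooth_on_differentiable smooth_graph Av.
have df : is_diff v f (projR \o 'd S v).
  exact: is_diff_comp (differentiableP dS) (is_diff_projR _).
have dpf : is_diff v (piR \o f) (piR \o (projR \o 'd S v)).
  exact: is_diff_comp df (is_diff_piR _).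
by split=> // h; rewrite (@diff_val _ _ _ _ _ _ _ dpf).
Qed.

Lemma immersion_piR_graph v : A v -> lift b v != 0 -> immersion_at (piR \o f) v.
Proof.
move=> Av bv; have [dpf dE] := diff_piR_graph Av; split=> // h.
rewrite dE => /piR_eq0[]; rewrite /cx /cy !crd_projR// => hX hY _ _ _.
have dS := smooth_on_differentiable smooth_graph Av.
have [eX _ eY _ _] := diff_graphE h dS; rewrite -/(cx _) eX in hX.
have [_ /(_ v h Av)[ey _ _ _]] := (integral_graphP _ _ _ _ _ _).1 Sint.
move: hY; rewrite -/(cy _) eY ey hX mulr0 add0r => /eqP.
rewrite mulf_eq0 (negPf bv) /= => /eqP hT.
by rewrite -(pt_crd h) hX hT; apply: crd_ext => -[|[|//]] _;
  rewrite crd_row_of_seq// /crd mxE.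
Qed.

(* Where b vanishes, d/dt is tangent to the surface and vertical for pi^2_1. *)
Lemma singular_piR_graph v : A v -> lift b v = 0 -> ~ immersion_at (piR \o f) v.
Proof.
move=> Av bv [_ inj]; have [_ dE] := diff_piR_graph Av.
have dS := smooth_on_differentiable smooth_graph Av.
have [eX _ eY eZ [eP eQ]] := diff_graphE (pt 0 1) dS.
have [_ /(_ v (pt 0 1) Av)[ey ez ep eq]] := (integral_graphP _ _ _ _ _ _).1 Sint.
rewrite bv crd0_pt mulr0 mul0r addr0 in ey.
rewrite ey in eY; rewrite ey crd0_pt !mulr0 addr0 in ez ep eq.
have : pt 0 1 = 0 :> 'rV[R]_2.
  apply: inj; rewrite dE; apply: crd_ext => k k5.
  rewrite crd_piR// crd_projR; last exact: leqW.
  rewrite [RHS]/crd mxE; move: k k5 => [|[|[|[|[|//]]]]] _.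
  - by rewrite -/(cx _) eX crd0_pt.
  - by rewrite -/(cy _) eY.
  - by rewrite -/(cz _) eZ ez.
  - by rewrite -/(cp _) eP ep.
  - by rewrite -/(cq _) eQ eq.
move=> /(congr1 (crd 1)); rewrite crd1_pt /crd mxE => /eqP.
by rewrite oner_eq0.
Qed.

Hypothesis b_slope : forall x t x', A (pt x t) -> A (pt x' t) ->
  b x' t = b x t + x - x'.

Lemma geometric_solution_graph : geometric_solution A f.
Proof.
split; first exact: integral_projected_graph.
have [_ _ _ _ bA] := smooth_components Aopen smooth_graph.
exists [set v | A v /\ lift b v != 0]; split=> /=.
- rewrite openE => v [Av bv]; rewrite /interior.
  have cb : {for v, continuous (lift b)}.
    exact/differentiable_continuous/(smooth_on_differentiable bA Av).
  apply: filterI; first exact: open_nbhs_nbhs.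
  have b_nbhs : nbhs (lift b v) [set r | r != 0].
    by apply: open_nbhs_nbhs; split => //; exact: open_neq.
  exact: cb b_nbhs.
- by move=> v [].
- move=> v Av N vN; have [b0|bn0] := eqVneq (lift b v) 0; last first.
    by exists v; split=> //; exact: nbhs_singleton.
  rewrite -(pt_crd v) in Av vN.
  have dx := is_diff_ptx (X v) (T v).
  have cx : {for X v, continuous (fun x => pt x (T v))}.
    exact: differentiable_continuous.
    have near_x : \forall x \near (X v)^', A (pt x (T v)) /\ N (pt x (T v)) /\ x != X v.
    near=> x; split; last split.
    + by near: x; apply: nbhs_dnbhs; exact: nbhs_slicex.
    + by near: x; apply: nbhs_dnbhs; exact: cx.
    + by near: x; exact: nbhs_dnbhs_neq.
  have [x [Ax [Nx xv]]] :=
    @filter_ex _ _ (Proper_dnbhs_numFieldType _) _ near_x.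
  exists (pt x (T v)); split=> //; split=> //=.
  by rewrite crd0_pt crd1_pt (b_slope Av Ax) b0 add0r subr_eq0 eq_sym; exact: xv.
- by move=> v [Av bv]; exact: immersion_piR_graph.
Unshelve. all: by end_near. Qed.

End Singularities.

Lemma explicit_solution_origin (R : realType) (A : set 'rV[R]_2)
    (y z p q b : R -> R -> R) (y0 Y P Q : R -> R) : A (pt 0 0) ->
  explicit_solution A y z p q b y0 Y P Q ->
  piR (projR (graph y z p q b (pt 0 0))) = 0 <->
    [/\ y0 0 = 0, Y 0 = 0, P 0 = 0 & Q 0 = 0].
Proof.
move=> A0 [_ _ _ /(_ _ _ A0)[ey ez ep eq _]].
have E k : (k < 5)%N -> crd k (piR (projR (graph y z p q b (pt 0 0)))) =
    [:: 0; y 0 0; z 0 0; p 0 0; q 0 0]`_k.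
  move=> k5; rewrite crd_piR// crd_projR; last exact: leqW.
  rewrite crd_graph; last by rewrite ltnS ltnW// ltnS ltnW.
  by rewrite crd0_pt crd1_pt; move: k k5 => [|[|[|[|[|//]]]]].
have {}ey : y 0 0 = y0 0 by rewrite ey; ring.
have {}ep : p 0 0 = - P 0 by rewrite ep; field.
have {}eq : q 0 0 = - Y 0 by rewrite eq; field.
have {}ez : z 0 0 = Q 0 / 2 - y0 0 * Y 0 by rewrite ez; field.
split=> [h|[y00 Y0 P0 Q0]]; last first.
  apply: crd_ext => k k5; rewrite E// ey ep eq ez y00 Y0 P0 Q0 [RHS]/crd mxE.
  by move: k k5 => [|[|[|[|[|//]]]]] _ /=; rewrite ?oppr0 ?mul0r ?subrr.
have {}E k : (k < 5)%N -> [:: 0; y 0 0; z 0 0; p 0 0; q 0 0]`_k = 0.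
  by move=> k5; rewrite -E// h /crd mxE.
have y00 := E 1%N isT; have z00 := E 2%N isT.
have p00 := E 3%N isT; have q00 := E 4%N isT.
rewrite /= ey in y00; rewrite /= ez y00 mul0r subr0 in z00.
rewrite /= ep in p00; rewrite /= eq in q00.
by split; lra.
Qed.

Unset Implicit Arguments.

Theorem mainTheorem5 (R : realType) (A : set 'rV[R]_2)
    (Aopen : open A) (A0 : A (pt 0 0))
    (Aslice : forall t : R, is_interval [set x | A (pt x t)])
    (y z p q b : R -> R -> R) :
  let S := graph y z p q b in
  let f := projR \o S in
  [/\ integral_submanifold Dhat_forms A S ->
        (through_Sigma1 y z p q b <-> derive1 (y 0) 0 = 0),
      (integral_submanifold Dhat_forms A S /\ through_Sigma1 y z p q b) <->
        (exists y0 Y P Q : R -> R, explicit_solution A y z p q b y0 Y P Q) &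
      forall y0 Y P Q : R -> R, explicit_solution A y z p q b y0 Y P Q ->
        [/\ singular_solution A f,
            ~ immersion_at (piR \o f) (pt 0 0) &
            piR (f (pt 0 0)) = 0 <->
              [/\ y0 0 = 0, Y 0 = 0, P 0 = 0 & Q 0 = 0]]].
Proof.
move=> S f; split.
- by move=> Sint; rewrite (derive_y_origin Aopen A0 Sint); exact: through_Sigma1P.
- split=> [[Sint /through_Sigma1P b0]|[y0 [Y [P [Q sol]]]]].
    exact: integral_explicit b0.
  split; first exact: explicit_integral sol.
  exact/through_Sigma1P/(explicit_b0 sol).
- move=> y0 Y P Q sol; have Sint := explicit_integral Aopen sol.
  have sing0 : ~ immersion_at (piR \o f) (pt 0 0).
    apply: (singular_piR_graph Sint A0); rewrite /= crd0_pt crd1_pt.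
    exact: explicit_b0 sol A0.
  split=> //; last exact: explicit_solution_origin sol.
  split; last by exists (pt 0 0).
  apply: geometric_solution_graph => // x t x' Ax Ax'.
  have [_ _ _ E] := sol.
  have [_ _ _ _ ->] := E _ _ Ax; have [_ _ _ _ ->] := E _ _ Ax'.
  ring.
Qed.
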